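(* Let $p\neq q$ be odd primes, $P$ a finite $p$-group and $Q$ a finite $q$-group acting on $P$; identify $P$ and $Q$ with their images in the semidirect product $QP=Q\ltimes P$. Let $\mathcal{T}$ be a finite-dimensional right $\mathbb{Z}_q[QP]$-module on which $P$ acts faithfully. Then there exists $\tau\in\mathcal{T}$ whose stabilizer $(QP)(\tau)$ in $QP$ equals $Q$.
   Context: $\mathbb{Z}_q$ denotes the field with $q$ elements. *)

(* Defs.v *)
From mathcomp Require Import all_boot all_order all_algebra all_fingroup all_solvable all_field all_character.
Set Implicit Arguments. Unset Strict Implicit. Unset Printing Implicit Defensive.

(* Main.v *)
Require Import Defs.
From mathcomp Require Import all_boot all_order all_algebra all_fingroup all_solvable all_field all_character.
Set Implicit Arguments. Unset Strict Implicit. Unset Printing Implicit Defensive.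

(** Since Q fixes the vector, its stabiliser is Q times a subgroup of P; so one
    needs a vector v fixed by Q with C_P(v) acting trivially.  Induct on the
    dimension, over arbitrary products G = PQ.

    - If U is a proper submodule and K = C_P(U), coprime action splits the module
      as C(K) + [., K]; add the vectors found in U and in [., K].
    - If G permutes transitively a system of blocks on which all point stabilisers
      in P agree, take u0 fixed by a Sylow q-subgroup of the stabiliser of a block
      j0.  The vectors whose components are G-conjugates of u0, with the sign
      changed on the Q-orbit of j0, form a Q-invariant set whose size is a power of
      p, so one of them is fixed by Q.  As G has odd order and q is odd, u0 and -u0
      are not conjugate, hence an element of P fixing this vector fixes j0, thus
      every block, thus every component.
    - If the module is irreducible and faithful and P contains a noncyclic abelian
      normal subgroup A of G, Clifford's theorem for A provides such blocks: group
      the homogeneous components into orbits of P, or of Phi(P) if P is transitive.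
    - Otherwise P has symplectic type, so P' <= Z(P), and any nonzero v fixed by Q
      works: D = C_P(v) meets Z(P) trivially, so D Z(P) is abelian and normal in G,
      hence cyclic, and D = 1. *)

Import GroupScope GRing.Theory.
Local Open Scope ring_scope.

(** * Direct sums of row spaces *)

Lemma mxrank_sums_leq (F : fieldType) n (K : finType) (J : {set K})
    (U : K -> 'M[F]_n) :
  (\rank (\sum_(j in J) U j)%MS <= \sum_(j in J) \rank (U j))%N.
Proof.
apply: (big_ind2 (fun (V : 'M_n) r => \rank V <= r)%N) => [|V r V' r' leV leV'|//].
  by rewrite mxrank0.
by rewrite (leq_trans (mxrank_adds_leqif _ _)) ?leq_add.
Qed.

Section DirectSums.

Variables (F : fieldType) (n : nat) (K : finType) (J : {set K}).
Variable U : K -> 'M[F]_n.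
Hypothesis dxU : mxdirect (\sum_(j in J) U j).

Lemma mxdirect_sum_inj (f h : K -> 'rV[F]_n) :
    {in J, forall j, (f j <= U j)%MS} -> {in J, forall j, (h j <= U j)%MS} ->
    \sum_(j in J) f j = \sum_(j in J) h j ->
  {in J, forall j, f j = h j}.
Proof.
move=> fU hU eq_fh j Jj; apply/eqP; rewrite -subr_eq0 -submx0.
rewrite -((mxdirect_sumsP dxU) j Jj) sub_capmx addmx_sub ?eqmx_opp ?fU ?hU //=.
move/eqP: eq_fh; rewrite -subr_eq0 -sumrB (bigD1 j) //= addr_eq0 => /eqP->.
rewrite eqmx_opp summx_sub_sums // => i /andP[Ji _].
by rewrite addmx_sub ?eqmx_opp ?fU ?hU.
Qed.

Lemma mxdirect_index_uniq (w : 'rV[F]_n) i j :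
  i \in J -> j \in J -> (w <= U i)%MS -> (w <= U j)%MS -> w != 0 -> i = j.
Proof.
move=> Ji Jj wUi wUj nzw; apply: contraNeq nzw => neq_ij.
rewrite -submx0 -((mxdirect_sumsP dxU) i Ji) sub_capmx wUi.
by apply: submx_trans wUj _; apply: (sumsmx_sup j); rewrite // Jj eq_sym.
Qed.

End DirectSums.

(** If [g] sent [u] to [- u], then [g ^+ 2] would fix [u], and so would [g], which is a power of
    [g ^+ 2] because its order is odd. *)
Lemma repr_opp_notin_orbit (F : fieldType) (gT : finGroupType) (G : {group gT})
    n (rG : mx_representation F G n) (u : 'rV[F]_n) g :
  odd #|G| -> (2%:R : F) != 0 -> u != 0 -> g \in G ->
  u *m rG g != (- u).
Proof.
move=> oddG nz2 nzu Gg; apply/eqP=> ugN.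
have sg2: (g ^+ 2)%g \in rstab rG u.
  by rewrite inE groupX //= expgS expg1 repr_mxM // mulmxA ugN mulNmx ugN opprK.
have sg: g \in rstab rG u.
  have oddg: odd #[g] by apply: dvdn_odd oddG; apply: order_dvdG.
  rewrite -[g]mulg1 -(expg_order g) -expgS -[_.+1]odd_double_half /= oddg.
  by rewrite -muln2 mulnC expgM groupX.
move: sg; rewrite inE ugN -subr_eq0 -opprD oppr_eq0 -mulr2n -scaler_nat.
by rewrite scaler_eq0 (negPf nz2) (negPf nzu) andbF.
Qed.

(** * Representations of products [PQ] in characteristic [q] *)

Section Fixed.

Variables (F : finFieldType) (p q : nat).
Hypotheses (p_pr : prime p) (q_pr : prime q) (odd_p : odd p) (odd_q : odd q).
Hypotheses (neq_pq : p != q) (pcharFq : q \in [pchar F]).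

Definition pq_product (gT : finGroupType) (G P Q : {group gT}) :=
  [/\ P <| G, (P * Q)%g = G, p.-group P & q.-group Q].

(* [v != 0] matters in the induction: signs must distinguish [v] from [- v]. *)
Definition has_Qfixed_Pfree (gT : finGroupType) (G P Q : {group gT}) n
    (rG : mx_representation F G n) :=
  exists v : 'rV[F]_n,
    [/\ (0 < n)%N -> v != 0, Q \subset rstab rG v
      & P :&: rstab rG v \subset rker rG].

(** A boolean form is wanted because socles are available only under [classically], which eliminates
    into booleans. *)
Lemma Qfixed_PfreeP (gT : finGroupType) (G P Q : {group gT}) n
    (rG : mx_representation F G n) :
  reflect (has_Qfixed_Pfree P Q rG)
    [exists v : 'rV[F]_n, [&& (0 < n)%N ==> (v != 0), Q \subset rstab rG v
                            & P :&: rstab rG v \subset rker rG]].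
Proof.
apply: (iffP existsP) => [[v /and3P[/implyP]] | [v [/implyP v0 Qv Pv]]]; exists v => //.
exact/and3P.
Qed.

Lemma pnat_q' m : p.-nat m -> q^'.-nat m.
Proof. by apply: sub_in_pnat => r _ /eqnP->; rewrite !inE. Qed.

Lemma pq_coprime m k : p.-nat m -> q.-nat k -> coprime m k.
Proof. by move/pnat_q'=> q'm qk; apply: p'nat_coprime q'm qk. Qed.

Lemma natr_pgroup_neq0 (gT : finGroupType) (K : {group gT}) :
  p.-group K -> (#|K|%:R : F) != 0.
Proof.
move=> pK; rewrite -(dvdn_pcharf pcharFq); apply: contra neq_pq => q_dv.
by rewrite eq_sym; apply: (pgroupP pK).
Qed.

(** * The inductive step, beginning with reducible modules *)

Section Reduction.

Variable n : nat.
Hypothesis IHn : forall m, (m < n)%N ->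
  forall (gT : finGroupType) (G P Q : {group gT})
         (rG : mx_representation F G m),
    pq_product G P Q -> has_Qfixed_Pfree P Q rG.

Variables (gT : finGroupType) (G P Q : {group gT}).
Variable rG : mx_representation F G n.
Hypothesis pqG : pq_product G P Q.

Lemma submod_Qfixed_Pfree (U : 'M[F]_n) :
    mxmodule rG U -> (\rank U < n)%N ->
  exists u : 'rV[F]_n,
    [/\ (u <= U)%MS, U != 0 -> u != 0, Q \subset rstab rG u
      & P :&: rstab rG u \subset rstab rG U].
Proof.
move=> modU ltUn.
have [u [nzu sQu sPu]] := IHn ltUn (submod_repr modU) pqG.
exists (val_submod u); split; first exact: val_submodP.
- by move=> nzU; rewrite val_submod_eq0 nzu // lt0n mxrank_eq0.
- by rewrite -(rstab_submod modU).
by rewrite -(rstab_submod modU) -(rker_submod modU).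
Qed.

Lemma reducible_Qfixed_Pfree (U : 'M[F]_n) :
  mxmodule rG U -> U != 0 -> (\rank U < n)%N -> has_Qfixed_Pfree P Q rG.
Proof.
move=> modU nzU ltUn; have [nsPG defG pP qQ] := pqG.
have [sPG nPG] := andP nsPG.
have [u1 [u1U /(_ nzU) nzu1 sQu1 sPu1]] := submod_Qfixed_Pfree modU ltUn.
pose K := (P :&: rstab rG U)%G.
have sKP: K \subset P by apply: subsetIl.
have sKG: K \subset G := subset_trans sKP sPG.
have nKG: G \subset 'N(K) by rewrite normsI ?rstab_norm.
(* Up to the scalar [c], [e] is the averaging projection onto the vectors fixed by [K]. It commutes
   with [G] because [K] is normal in [G], so its kernel [U2] is a submodule, namely the commutator
   part of the splitting. *)
pose e := (\sum_(k in K) rG k); pose c := (#|K|%:R : F).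
have nzc: c != 0 by rewrite natr_pgroup_neq0 // (pgroupS sKP).
have eG g: g \in G -> (e *m rG g = rG g *m e).
  move=> Gg; rewrite mulmx_suml mulmx_sumr.
  rewrite [RHS](reindex_inj (conjg_inj g)) /=; apply/eq_big => [k | k Kk].
    by rewrite memJ_norm ?(subsetP nKG).
  have Gk := subsetP sKG k Kk.
  by rewrite -!repr_mxM ?groupJ // -conjgC.
have eK k: k \in K -> (e *m rG k = e).
  move=> Kk; rewrite mulmx_suml [RHS](reindex_inj (mulIg k)) /=.
  by apply/eq_big => [x | x Kx]; rewrite ?groupMr ?repr_mxM ?(subsetP sKG).
have fixe (w : 'rV[F]_n) : {in K, forall k, w *m rG k = w} -> (w *m e = c *: w).
  move=> wK; rewrite mulmx_sumr (eq_bigr (fun=> w)) ?sumr_const ?scaler_nat //.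
have fixU (w : 'rV[F]_n) : (w <= U)%MS -> {in K, forall k, w *m rG k = w}.
  move=> wU k /setIP[_ /setIdP[_ /eqP kU]]; have [D ->] := submxP wU.
  by rewrite -mulmxA kU.
pose U2 := kermx e.
have modU2: mxmodule rG U2.
  apply/mxmoduleP=> g Gg; apply/sub_kermxP.
  by rewrite -mulmxA -eG // mulmxA mulmx_ker mul0mx.
(* [e] multiplies the nonzero vector [u1] by [c], so [U2] is proper. *)
have ltU2n: (\rank U2 < n)%N.
  rewrite ltn_neqAle rank_leq_row andbT; apply: contra nzu1 => fullU2.
  have /sub_kermxP: (u1 <= U2)%MS by apply: submx_full.
  by rewrite fixe; [move/eqP; rewrite scaler_eq0 (negPf nzc) | apply: fixU].
have [u2 [u2U2 _ sQu2 sPu2]] := submod_Qfixed_Pfree modU2 ltU2n.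
have dxU (w1 w2 : 'rV[F]_n) :
  (w1 <= U)%MS -> (w2 <= U2)%MS -> (w1 + w2 = 0) -> (w1 = 0 /\ w2 = 0).
- move=> w1U /sub_kermxP w2e w0.
  have: ((w1 + w2) *m e = 0) by rewrite w0 mul0mx.
  rewrite mulmxDl w2e addr0 fixe; last exact: fixU.
  move/eqP; rewrite scaler_eq0 (negPf nzc) /= => /eqP w10.
  by move: w0; rewrite w10 add0r.
exists (u1 + u2); split.
- by move=> _; apply: contra nzu1 => /eqP/(dxU _ _ u1U u2U2)[-> _].
- apply/subsetP=> x Qx; move: (subsetP sQu1 x Qx) (subsetP sQu2 x Qx).
  by rewrite !inE mulmxDl => /andP[-> /eqP->] /andP[_ /eqP->] /=.
apply/subsetP=> g /setIP[Pg /setIdP[Gg /eqP fixg]].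
have [|||/eqP + /eqP] := dxU (u1 *m rG g - u1) (u2 *m rG g - u2).
- by rewrite addmx_sub ?eqmx_opp // (submx_trans (submxMr _ u1U)) ?(mxmoduleP modU).
- by rewrite addmx_sub ?eqmx_opp // (submx_trans (submxMr _ u2U2)) ?(mxmoduleP modU2).
- by rewrite addrACA -opprD -mulmxDl fixg subrr.
rewrite !subr_eq0 => gu1 gu2.
have Ug: g \in rstab rG U by rewrite (subsetP sPu1) // !inE Pg Gg.
have U2g: g \in rstab rG U2 by rewrite (subsetP sPu2) // !inE Pg Gg.
have Kg: g \in K by rewrite inE Pg.
rewrite inE Gg mul1mx.
(* The complementary projection lands in [U2], where [g] acts trivially, and [e] absorbs [g] on the
   right; so [g] is trivial on both summands. *)
have s1: (1%:M - c^-1 *: e <= U2)%MS.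
  apply/sub_kermxP; rewrite mulmxBl mul1mx -scalemxAl.
  rewrite {2}/e mulmx_sumr (eq_bigr (fun=> e)) ?sumr_const; last exact: eK.
  by rewrite -scaler_nat scalerA mulVf // scale1r subrr.
have [D defD] := submxP s1.
move: U2g; rewrite inE => /andP[_ /eqP U2g].
rewrite -[rG g]mul1mx -[X in X *m _](subrK (c^-1 *: e)) mulmxDl defD -mulmxA U2g.
by rewrite -defD -scalemxAl eK // subrK eqxx.
Qed.

(** * Transitive systems of blocks *)

Section Blocks.

Variables (K : finType) (to : action G K) (J : {set K}) (U : K -> 'M[F]_n).
Hypotheses (trJ : [transitive G, on J | to]) (J_gt1 : (1 < #|J|)%N).
Hypothesis nzU : {in J, forall j, U j != 0}.
Hypothesis UG : {in J & G, forall j g, (U j *m rG g <= U (to j g))%MS}.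
Hypothesis dxU : mxdirect (\sum_(j in J) U j).
Hypothesis sumU : (\sum_(j in J) U j :=: 1%:M)%MS.
Hypothesis semiregP : forall g i j,
  g \in P -> i \in J -> j \in J -> to i g = i -> to j g = j.

Lemma block_rank_lt j : j \in J -> (\rank (U j) < n)%N.
Proof.
move=> Jj; have := mxdirectP dxU; rewrite /= sumU mxrank1 (bigD1 j) //= => defn.
rewrite [X in (_ < X)%N]defn.
have [JD0 | [i /setD1P[neq_ij Ji]]] := set_0Vmem (J :\ j).
  by move: J_gt1; rewrite (cardsD1 j) Jj JD0 cards0.
rewrite (bigD1 i) ?Ji //= -[X in (X < _)%N]addn0 ltn_add2l addn_gt0 lt0n.
by rewrite mxrank_eq0 nzU.
Qed.

Lemma block_act j g : j \in J -> g \in G -> to j g \in J.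
Proof.
by move=> Jj Gg; rewrite -(atransPin (subxx G) trJ Jj) mem_orbit.
Qed.

Lemma block_trans i j : i \in J -> j \in J -> exists2 g, g \in G & j = to i g.
Proof. by move=> Ji; rewrite -(atransPin (subxx G) trJ Ji) => /orbitP[g]; exists g. Qed.

Lemma block_eq i g : i \in J -> g \in G -> (U (to i g) :=: U i *m rG g)%MS.
Proof.
move=> Ji Gg; apply/eqmxP; rewrite UG // andbT.
have /UG/(_ (groupVr Gg)): to i g \in J by apply: block_act.
rewrite -actMin ?groupV // mulgV act1 => /(submxMr (rG g)).
by rewrite -mulmxA -repr_mxM ?groupV // mulVg repr_mx1 mulmx1.
Qed.

(** A Sylow [q]-subgroup of any block stabiliser is conjugate into [Q]; moving the block by the
    conjugating element gives [j0]. *)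
Lemma exists_split_stabiliser : exists2 j0, j0 \in J
  & ((P :&: 'C_G[j0 | to]) * (Q :&: 'C_G[j0 | to]))%g = 'C_G[j0 | to].
Proof.
have [nsPG defG pP qQ] := pqG; have [sPG nPG] := andP nsPG.
have coPQ: coprime #|P| #|Q| by apply: pq_coprime.
have sylQ: q.-Sylow(G) Q.
  rewrite pHallE -defG mulG_subr coprime_cardMg //= partnM //.
  by rewrite (part_pnat_id qQ) (part_p'nat (pnat_q' pP)) mul1n ?eqxx.
have [j1 Jj1 _] := imsetP trJ.
have [R sylR] := Sylow_exists q 'C_G[j1 | to].
have [sRM qR _] := and3P sylR.
have [x Gx sRxQ] := Sylow_Jsub sylQ (subset_trans sRM (subsetIl _ _)) qR.
exists (to j1 x); first exact: block_act.
pose M := ('C_G[to j1 x | to])%G.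
have defM: M :=: 'C_G[j1 | to] :^ x.
  by rewrite /= conjIg -astab1_act_in // conjGid.
pose N := (P :&: 'C_G[to j1 x | to])%G.
have sRxM: R :^ x \subset M by rewrite defM conjSg.
have sMG: M \subset G by apply: subsetIl.
have qMP: q.-nat #|M : P|.
  rewrite -card_quotient ?(subset_trans sMG) //.
  have: (M / P \subset Q / P)%g by rewrite -(quotientMidl P Q) defG quotientS.
  by move/pgroupS; apply; apply: quotient_pgroup.
have cardM: #|M| = (#|N| * #|M : P|)%N by rewrite -(LagrangeI M P) setIC.
have pN: p.-group N by apply: pgroupS pP; apply: subsetIl.
have cardR: #|R| = #|M : P|.
  rewrite (card_Hall sylR) -(cardJg _ x) -defM cardM partnM //.
  by rewrite (part_pnat_id qMP) (part_p'nat (pnat_q' pN)) mul1n ?eqxx.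
apply/eqP; rewrite eqEcard mul_subG ?subsetIr //=.
apply: (@leq_trans #|(N * (R :^ x))%g|); last first.
  by rewrite subset_leq_card // mulgS // subsetI sRxQ.
rewrite coprime_cardMg ?cardJg ?cardR ?cardM //.
exact: pq_coprime.
Qed.

Lemma mem_stabiliser g j : g \in G -> (g \in 'C[j | to]) = (to j g == j).
Proof. by move=> Gg; rewrite !inE Gg sub1set inE. Qed.

(** The induction hypothesis applies to the stabiliser of [j0] acting on [U j0]. An element of [Q]
    fixing [u0] also fixes [j0], because a nonzero vector lies in only one block. *)
Lemma exists_base_vector : exists j0 (u0 : 'rV[F]_n),
  [/\ j0 \in J, (u0 <= U j0)%MS, u0 != 0,
      (P :&: 'C[j0 | to]) * (Q :&: rstab rG u0) = 'C_G[j0 | to]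
    & P :&: 'C[j0 | to] :&: rstab rG u0 \subset rstab rG (U j0)]%g.
Proof.
have [nsPG defG pP qQ] := pqG; have [sPG nPG] := andP nsPG.
have [j0 Jj0 defM] := exists_split_stabiliser; exists j0.
set M := 'C_G[j0 | to]%G in defM; have sMG: M \subset G by apply: subsetIl.
have modU: mxmodule (subg_repr rG sMG) (U j0).
  apply/mxmoduleP=> g /setIP[Gg]; rewrite mem_stabiliser // => /eqP cg.
  rewrite /= -[X in (_ <= U X)%MS]cg.
  exact: UG.
have pqM: pq_product M (P :&: M)%G (Q :&: M)%G.
  split=> //; first by rewrite /= setIC (normalGI sMG).
    by apply: pgroupS pP; apply: subsetIl.
  by apply: pgroupS qQ; apply: subsetIl.
have [u []] := IHn (block_rank_lt Jj0) (submod_repr modU) pqM.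
rewrite rstab_submod rker_submod !rstab_subg => nzu sQu sPu.
have sQG: Q \subset G by rewrite -defG mulG_subr.
have defPM: P :&: M = P :&: 'C[j0 | to] by rewrite /= setIA (setIidPl sPG).
have wU := val_submodP u; move: (val_submod u) (val_submod_eq0 u) => w w0 in sQu sPu wU *.
have nzw: w != 0 by rewrite w0 nzu // lt0n mxrank_eq0 nzU.
exists w; split=> //.
  apply/eqP; rewrite eqEsubset; apply/andP; split; last first.
    apply: (@subset_trans _ _ ((P :&: M) * (Q :&: M))%g); first by rewrite defM.
    rewrite -defPM mulgS // subsetI subsetIl.
    by apply: subset_trans sQu _; apply: subsetIr.
  apply: mul_subG; first by rewrite setSI.
  apply/subsetP=> g /setIP[Qg sg]; have Gg := subsetP sQG g Qg.
  rewrite inE Gg mem_stabiliser //; apply/eqP.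
  apply: (mxdirect_index_uniq dxU (w := w)) => //; first exact: block_act.
  by move: sg; rewrite inE Gg => /eqP {1}<-; rewrite (submx_trans (submxMr _ wU)) ?UG.
apply/subsetP=> g /setIP[Pcg wg]; have PMg: g \in P :&: M by rewrite defPM.
have [_ Mg] := setIP PMg.
have /setIP[] //: g \in M :&: rstab rG (U j0).
by apply: (subsetP sPu); rewrite in_setI; apply/andP; split=> //; rewrite inE Mg.
Qed.

Lemma blocks_Qfixed_Pfree : has_Qfixed_Pfree P Q rG.
Proof.
have [nsPG defG pP qQ] := pqG; have [sPG nPG] := andP nsPG.
have [j0 [u0 [Jj0 u0U nzu0 defM sPu0]]] := exists_base_vector.
have sQG: Q \subset G by rewrite -defG mulG_subr.
have tiPQ: P :&: Q = 1%g by rewrite coprime_TIg // pq_coprime.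
have oddG: odd #|G|.
  rewrite -defG coprime_cardMg ?pq_coprime // oddM.
  by rewrite (odd_pgroup_odd odd_p pP) (odd_pgroup_odd odd_q qQ).
have nz2: (2%:R : F) != 0.
  rewrite -(dvdn_pcharf pcharFq) dvdn_prime2 //.
  by apply: contraTneq odd_q => ->.
pose O := [set u0 *m rG g | g in G].
have OG w g : w \in O -> g \in G -> w *m rG g \in O.
  case/imsetP=> h Gh -> Gg; rewrite -mulmxA -repr_mxM //.
  by apply/imsetP; exists (h * g)%g; rewrite ?groupM.
have ON w : w \in O -> - w \notin O.
  case/imsetP=> h Gh ->; apply/negP=> /imsetP[k Gk] eq_hk.
  suff: u0 *m rG (k * h^-1)%g == - u0.
    by apply/negP; apply: repr_opp_notin_orbit; rewrite ?groupM ?groupV.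
  rewrite repr_mxM ?groupV // mulmxA -eq_hk mulNmx -mulmxA -repr_mxM ?groupV //.
  by rewrite mulgV repr_mx1 mulmx1.
have nzO w : w \in O -> w != 0.
  by move=> Ow; apply: contraTneq (ON w Ow) => w0; rewrite negbK w0 oppr0 -w0.
have Oblock w j : j \in J -> w \in O -> (w <= U j)%MS ->
  exists2 g, g \in G & w = u0 *m rG g /\ j = to j0 g.
- move=> Jj Ow wU; have /imsetP[g Gg defw] := Ow; exists g => //; split=> //.
  apply: (mxdirect_index_uniq dxU (w := w)) => //; [exact: block_act | | exact: nzO].
  by rewrite defw (submx_trans (submxMr _ u0U)) ?UG.
have JG j g : g \in G -> (to j g \in J) = (j \in J).
  move=> Gg; apply/idP/idP=> [Jjg | Jj]; last exact: block_act.
  by rewrite -(actKin to Gg j) block_act ?groupV.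
(* This sign is constant on [Q]-orbits, which makes the set [X] below stable under [Q]. *)
pose eps j : F := (-1) ^+ (j \in orbit to Q j0).
have epsK j : eps j * eps j = 1 by rewrite -expr2 sqrr_sign.
have nzeps j : eps j != 0 by rewrite signr_eq0.
have epsQ j g : g \in Q -> eps (to j g) = eps j.
  move=> Qg; rewrite /eps; congr ((-1) ^+ (nat_of_bool _)).
  exact: orbit_actr_in.
pose Fj j := [set v : 'rV[F]_n | (v <= U j)%MS & eps j *: v \in O].
have pFj j : j \in J -> p.-nat #|Fj j|.
  move=> Jj; have [x Gx defj] := block_trans Jj0 Jj.
  set N := (P :&: 'C[j0 | to])%G.
  have sNG: N \subset G by apply: subset_trans sPG; apply: subsetIl.
  (* Two elements of [G] sending [j0] to [j] differ by the stabiliser of [j0], which is [N] times a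
     group fixing [u0]. So the candidates form, up to sign and translation by [x], a single
     [N]-orbit. *)
  have ->: Fj j = [set eps j *: (u *m rG x) | u in orbit (mx_repr_action rG) N u0].
    apply/setP=> v; apply/idP/imsetP => [|[_ /orbitP[g Ng <-] ->]].
      rewrite inE => /andP[vU vO].
      have [|g Gg [defv defjg]] := Oblock _ j Jj vO; first exact: scalemx_sub.
      have: (g * x^-1)^-1%g \in 'C_G[j0 | to].
        rewrite groupV inE groupM ?groupV //= mem_stabiliser ?groupM ?groupV //.
        by rewrite actMin ?groupV // -defjg defj actKin.
      rewrite -defM => /mulsgP[y z Ny /setIP[Qz sz] defyz].
      have [Gy Gz] := (subsetP sNG y Ny, subsetP sQG z Qz).
      exists (u0 *m rG y^-1%g).
        by rewrite -mx_repr_actE ?groupV // mem_orbit ?groupV.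
      have defg: (g = z^-1 * (y^-1 * x))%g.
        by rewrite mulgA -invMg -defyz invgK mulgKV.
      have/setIdP[_ /eqP uz] := groupVr sz.
      rewrite -[v]scale1r -(epsK j) -scalerA defv defg.
      by rewrite !repr_mxM ?groupM ?groupV // !mulmxA uz.
    have [Gg [_ cg]] := (subsetP sNG g Ng, setIP Ng).
    rewrite inE scalerA epsK scale1r /= mx_repr_actE // OG ?OG ?imset_f //; last first.
      by apply/imsetP; exists 1%g; rewrite ?group1 ?repr_mx1 ?mulmx1.
    rewrite andbT scalemx_sub // defj; move: cg; rewrite mem_stabiliser // => /eqP cg.
    rewrite (submx_trans _ (UG Jj0 Gx)) // submxMr // -[X in U X]cg.
    by rewrite (submx_trans _ (UG Jj0 Gg)) // submxMr.
  rewrite card_imset => [|u w /= /(scalerI (nzeps j)) eq_uw]; last first.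
    by apply: row_free_inj eq_uw; rewrite repr_mx_free.
  rewrite card_orbit_in // (pnat_dvd (dvdn_indexg _ _)) //.
  by apply: pgroupS pP; apply: subsetIl.
(* Vanishing outside [J] makes each choice function recoverable from its sum, so the size of [X] is
   the product of the sizes of the [Fj j]. *)
pose X := [set \sum_(j in J) f j | f : {ffun K -> 'rV[F]_n} in pfamily 0 J (fun j => mem (Fj j))].
have FjU (f : {ffun K -> 'rV[F]_n}) :
  f \in pfamily 0 J (fun j => mem (Fj j)) -> {in J, forall j, (f j <= U j)%MS}.
- by case/pfamilyP=> _ fF j /fF; rewrite inE => /andP[].
have q'X: ~~ (q %| #|X|)%N.
  rewrite -p'natE // pnat_q' // card_in_imset => [|f h Ff Fh eq_fh].
    rewrite card_pfamily /image_mem; have: {subset enum J <= J}.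
      by move=> j; rewrite mem_enum.
    elim: (enum J) => //= j s IHs sJ; rewrite pnatM pFj ?sJ ?mem_head //=.
    by apply: IHs => i si; rewrite sJ // inE si orbT.
  apply/ffunP=> j; have [Jj | J'j] := boolP (j \in J).
    by apply: (mxdirect_sum_inj dxU _ _ eq_fh) Jj; apply: FjU.
  have [/supportP sf _] := pfamilyP Ff.
  have [/supportP sh _] := pfamilyP Fh.
  by rewrite sf // sh.
have sumG (f : K -> 'rV[F]_n) g : g \in G ->
  (\sum_(j in J) f j) *m rG g = \sum_(j in J) f (to j g^-1%g) *m rG g.
- move=> Gg; rewrite mulmx_suml (reindex_inj (act_inj to g^-1%g)) /=.
  by apply: eq_bigl => j; rewrite JG ?groupV.
have actX : [acts Q, on X | mx_repr_action rG].
  apply/subsetP=> g Qg; have Gg := subsetP sQG g Qg; rewrite !inE Gg /=.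
  apply/subsetP=> _ /imsetP[f Ff ->]; have [_ fF] := pfamilyP Ff.
  rewrite inE /= mx_repr_actE // sumG //; apply/imsetP.
  exists [ffun j => if j \in J then f (to j g^-1%g) *m rG g else 0]; last first.
    by apply: eq_bigr => j Jj; rewrite ffunE Jj.
  apply/pfamilyP; split=> [|j Jj].
    by apply/supportP=> j /negPf J'j; rewrite ffunE J'j.
  have Jjg: to j g^-1%g \in J by rewrite JG ?groupV.
  move: (fF _ Jjg); rewrite ffunE Jj !inE epsQ ?groupV // => /andP[fU fO].
  rewrite scalemxAl OG // andbT -[X in U X](actKVin to Gg).
  by rewrite (submx_trans _ (UG Jjg Gg)) ?submxMr.
have [v]: exists v, v \in 'Fix_(X | mx_repr_action rG)(Q).
  apply/set0Pn; rewrite -card_gt0 lt0n; apply: contra q'X => /eqP fix0.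
  by rewrite /dvdn (pgroup_fix_mod qQ actX) fix0 mod0n.
case/setIP=> /imsetP[f Ff defv] /afixP fixv.
have [_ fF] := pfamilyP Ff.
have nzf0 j : j \in J -> f j != 0.
  by move/fF; rewrite inE => /andP[_ /nzO]; apply: contraNneq => ->; rewrite scaler0.
exists v; split=> [_|| ].
- apply: contraNneq (nzf0 _ Jj0) => v0; apply/eqP.
  apply: (mxdirect_sum_inj dxU (h := fun=> 0)) Jj0 => [||]; first exact: FjU.
    by move=> *; apply: sub0mx.
  by rewrite -defv v0 big1.
- apply/subsetP=> g Qg; have Gg := subsetP sQG g Qg.
  by rewrite inE Gg -mx_repr_actE //=; apply/eqP; apply: fixv.
apply/subsetP=> g /setIP[Pg /setIdP[Gg /eqP vg]].
have fg j : j \in J -> f (to j g) = f j *m rG g.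
  move=> Jj; have Jjg: to j g \in J by rewrite JG.
  rewrite -[in RHS](actKin to Gg j).
  apply: (mxdirect_sum_inj dxU (h := fun i => f (to i g^-1%g) *m rG g)) Jjg.
  - exact: FjU.
  - move=> i Ji; have Jig: to i g^-1%g \in J by rewrite JG ?groupV.
    rewrite -[X in U X](actKVin to Gg) (submx_trans _ (UG Jig Gg)) // submxMr //.
    exact: FjU.
  by rewrite -sumG // -defv vg.
(* If [g] moved [j0] out of its [Q]-orbit, the signs would put both [f j0] and [- f j0] in [O].
   Otherwise some [y] in [Q] moves [j0] as [g] does, and writing [g * y^-1] as [a * b] puts
   [a^-1 * g] in both [P] and [Q], so [g] is [a], which fixes [j0]. *)
have cj0: to j0 g = j0.
  have Jj0g: to j0 g \in J by rewrite JG.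
  have := fF _ Jj0g; have := fF _ Jj0; rewrite !inE fg // /eps orbit_refl.
  rewrite expr1 scaleN1r => /andP[_ fO] /andP[_].
  have [/orbitP[y Qy cgy] _ | _] := boolP (_ \in orbit _ _ _); last first.
    rewrite expr0 scale1r => /OG/(_ (groupVr Gg)).
    rewrite -mulmxA -repr_mxM ?groupV // mulgV repr_mx1 mulmx1 => /ON.
    by rewrite fO.
  have Gy := subsetP sQG y Qy.
  have: (g * y^-1)%g \in 'C_G[j0 | to].
    rewrite inE groupM ?groupV //= mem_stabiliser ?groupM ?groupV //.
    by rewrite actMin ?groupV // -cgy actKin.
  rewrite -defM => /mulsgP[a b /setIP[Pa ca] /setIP[Qb _] def_gy].
  have: (a^-1 * g)%g \in P :&: Q.
    rewrite inE groupM ?groupV //=.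
    by rewrite -[g](mulgKV y) def_gy -mulgA mulKg groupM.
  rewrite tiPQ => /set1P/eqP; rewrite -eq_mulVg1 => /eqP <-.
  by move: ca; rewrite mem_stabiliser ?(subsetP sPG) // => /eqP.
have cJ j : j \in J -> to j g = j by move=> Jj; apply: semiregP cj0.
rewrite -[rker _]/(rstab rG 1%:M) -(eqmx_rstab _ sumU) -sub1set.
rewrite rfix_mx_rstabC ?sub1set //; apply/sumsmx_subP=> j Jj.
rewrite -rfix_mx_rstabC ?sub1set //.
have := fF _ Jj; rewrite inE => /andP[fU fO].
have [|h Gh [def_fh defj]] := Oblock _ j Jj fO; first exact: scalemx_sub.
rewrite defj (eqmx_rstab _ (block_eq Jj0 Gh)).
have Gk: (g ^ h^-1)%g \in G by rewrite groupJ ?groupV.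
have defk: (g ^ h^-1 * h = h * g)%g by rewrite conjgE invgK -!mulgA mulVg mulg1.
(* Pulled back along [h], the element [g] fixes [j0] and [u0], so it acts trivially on [U j0]. *)
have: (g ^ h^-1)%g \in rstab rG (U j0).
  apply: (subsetP sPu0); rewrite 2!in_setI mem_stabiliser // memJ_norm ?Pg /=; last first.
    by rewrite groupV (subsetP nPG).
  rewrite -(inj_eq (act_inj to h)) -actMin // defk actMin // -defj cJ // eqxx /=.
  rewrite inE Gk; apply/eqP/(can_inj (repr_mxK rG Gh)).
  rewrite -mulmxA -repr_mxM // defk repr_mxM // mulmxA -def_fh -scalemxAl.
  by rewrite -fg // cJ.
rewrite !inE Gg Gk => /eqP Uk.
by rewrite -mulmxA -repr_mxM // -defk repr_mxM // mulmxA Uk eqxx.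
Qed.

End Blocks.

(** * Faithful irreducible modules with [P] of symplectic type *)

Section Primitive.

Hypotheses (irrG : mx_irreducible rG) (ffulG : mx_faithful rG).
Hypothesis cyclic_normal : forall A : {group gT},
  A <| G -> A \subset P -> abelian A -> cyclic A.

(** [P] is a central product of [E], trivial or extraspecial, with [R], cyclic since [p] is odd. So
    [P] and [E] have the same derived subgroup, which is central in [E] and hence in [P]. *)
Lemma der1_sub_center : P^`(1)%g \subset 'Z(P).
Proof.
have [nsPG defG pP qQ] := pqG.
have [|E defE [R [cycR defP _]]] := symplectic_type_group_structure pP.
  move=> X charX; apply: cyclic_normal; last exact: char_sub charX.
  exact: char_normal_trans charX nsPG.
have{} cycR: cyclic R by case: cycR => // -[p2 _ _]; move: odd_p; rewrite p2.
have cRR := cyclic_abelian cycR.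
have [_ <- _] := cprodP (der_cprod 1 defP); rewrite (derG1P cRR) mulg1.
have [_ <- _] := cprodP (center_cprod defP); apply: subset_trans (mulG_subl _ _).
case: defE => [-> | esE]; first by rewrite derg1 commG1 sub1G.
by have [[_ ->] _] := esE.
Qed.

Lemma primitive_Qfixed_Pfree : has_Qfixed_Pfree P Q rG.
Proof.
have [nsPG defG pP qQ] := pqG; have [sPG nPG] := andP nsPG.
have sQG: Q \subset G by rewrite -defG mulG_subr.
have /mx_irrP[n_gt0 simG] := irrG.
have nzQ := rfix_pgroup_pchar pcharFq rG n_gt0 qQ sQG.
pose v := nz_row (rfix_mx rG Q).
have nzv: v != 0 by rewrite nz_row_eq0.
have sQv: Q \subset rstab rG v by rewrite rfix_mx_rstabC // nz_row_sub.
exists v; split=> //; pose D := (P :&: rstab rG v)%G; pose Z := 'Z(P)%G.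
have sZP: Z \subset P by apply: center_sub.
have sDP: D \subset P by apply: subsetIl.
have nQP: Q \subset 'N(P) := subset_trans sQG nPG.
have nQD: Q \subset 'N(D) by rewrite normsI // (subset_trans sQv) ?normG.
have nQZ: Q \subset 'N(Z) by rewrite (char_norm_trans (center_char P)).
have cPZ: P \subset 'C(Z) by rewrite centsC subsetIr.
(* This intersection is centralised by [P] and normalised by [Q], so its fixed space is a submodule.
   That space contains [v], hence is everything, and faithfulness applies. *)
have tiDZ: D :&: Z = 1%g.
  pose T := (D :&: Z)%G.
  have sTG: T \subset G by rewrite (subset_trans (subsetIl _ _)) // (subset_trans sDP).
  have nsTG: T <| G.
    rewrite /normal sTG -defG mul_subG //; last exact: normsI.
    by rewrite cents_norm // (subset_trans cPZ) // centS // subsetIr.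
  have nzT: rfix_mx rG T != 0.
    apply: contraNneq nzv => T0; rewrite -submx0 -T0 -rfix_mx_rstabC //.
    by rewrite (subset_trans (subsetIl _ _)) // subsetIr.
  apply/trivgP; apply: subset_trans ffulG; rewrite rfix_mx_rstabC //.
  by rewrite submx_full // simG // normal_rfix_mx_module.
(* The derived subgroup of [D] lies in [D] and, like that of [P], in [Z]. *)
have cDD: abelian D.
  apply/derG1P/eqP; rewrite -subG1 -tiDZ subsetI der_sub.
  by rewrite (subset_trans _ der1_sub_center) // dergS.
have cDZ: D \subset 'C(Z) := subset_trans sDP cPZ.
pose B := (D <*> Z)%G.
have sBP: B \subset P by rewrite join_subG sDP.
have cBB: abelian B by rewrite abelianY cDD center_abelian centsC.
have nsBG: B <| G.
  rewrite /normal (subset_trans sBP) //= -defG mul_subG //; last exact: normsY.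
  by rewrite sub_der1_norm // (subset_trans der1_sub_center) // joing_subr.
have cycB := cyclic_normal nsBG sBP cBB.
have [D1 | ntD] := eqVneq (D : {set gT}) 1%g.
  by rewrite -[P :&: _]/(gval D) D1 sub1G.
have ntZ: Z != 1%g :> {set gT}.
  apply: contraNneq ntD => Z1; rewrite -subG1 -(trivg_center_pgroup pP Z1) //.
(* If [D] were nontrivial, [D] and [Z] would each contain a subgroup of order [p]; the cyclic group
   [B] has only one, against [tiDZ]. *)
have [_ pD _] := pgroup_pdiv (pgroupS sDP pP) ntD.
have [_ pZ _] := pgroup_pdiv (pgroupS sZP pP) ntZ.
have [x Dx ox] := Cauchy p_pr pD; have [z Zz oz] := Cauchy p_pr pZ.
have sxB: <[x]> \subset B by rewrite cycle_subG mem_gen // inE Dx.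
have szB: <[z]> \subset B by rewrite cycle_subG mem_gen // inE Zz orbT.
have eqxz: <[x]> :=: <[z]>.
  by apply/eqP; rewrite (eq_subG_cyclic cycB) // -!orderE ox oz.
have: x \in D :&: Z by rewrite inE Dx -cycle_subG eqxz cycle_subG.
rewrite tiDZ => /set1P x1; move: ox; rewrite x1 order1 => p1.
by move: p_pr; rewrite -p1.
Qed.

End Primitive.

(** * Blocks obtained by merging the orbits of a normal subgroup *)

Section OrbitBlocks.

Variables (I : finType) (to : action G I) (W : I -> 'M[F]_n) (L : {group gT}).
Hypotheses (nsLG : L <| G) (trI : [transitive G, on setT | to]).
Hypothesis ntrL : ~~ [transitive L, on setT | to].
Hypothesis nzW : forall i, W i != 0.
Hypothesis WG : forall i g, g \in G -> (W i *m rG g <= W (to i g))%MS.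
Hypothesis dxW : mxdirect (\sum_i W i).
Hypothesis sumW : (\sum_i W i :=: 1%:M)%MS.
Hypothesis semiregL : forall g i j, g \in P ->
  to i g \in orbit to L i -> to j g \in orbit to L j.

Let sLG := normal_sub nsLG.

Lemma setact_orbit_normal i g :
  g \in G -> (to^*)%act (orbit to L i) g = orbit to L (to i g).
Proof.
move=> Gg; have nLg: g \in 'N(L) by rewrite (subsetP (normal_norm nsLG)).
apply/setP=> j; apply/imsetP/orbitP => [[_ /orbitP[x Lx <-] ->] | [x Lx <-]].
  have Gx := subsetP sLG x Lx; exists (x ^ g)%g; first by rewrite memJ_norm.
  by rewrite -!actMin ?groupJ // -conjgC.
have Gx := subsetP sLG x Lx; exists (to i (x ^ g^-1)%g).
  by rewrite mem_orbit // memJ_norm ?groupV.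
by rewrite -!actMin ?groupJ ?groupV // conjgCV.
Qed.

(** Summing [W] over each [L]-orbit gives the blocks: [ntrL] provides at least two, and [semiregL]
    makes their stabilisers in [P] agree. *)
Lemma orbit_blocks_Qfixed_Pfree : has_Qfixed_Pfree P Q rG.
Proof.
have [nsPG defG pP qQ] := pqG; have [sPG _] := andP nsPG.
pose J := orbit to L @: setT; pose U (S : {set I}) := (\sum_(i in S) W i)%MS.
have actL: [acts L, on setT | to].
  by apply/subsetP=> g Lg; rewrite !inE (subsetP sLG) //=; apply/subsetP=> i _; rewrite !inE.
have /and3P[/eqP covJ tiJ _] := orbit_partition actL.
have bigJ (R : Type) (idx : R) (op : Monoid.com_law idx) E :
  \big[op/idx]_(S in J) \big[op/idx]_(i in S) E i = \big[op/idx]_i E i.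
- by rewrite -big_trivIset // covJ; apply: eq_bigl => i; rewrite inE.
have sumU: (\sum_(S in J) U S :=: 1%:M)%MS by rewrite bigJ.
apply: (@blocks_Qfixed_Pfree _ (to^*)%act J U) => //.
- have [i0 _ _] := imsetP trI; apply/imsetP; exists (orbit to L i0); first exact: imset_f.
  apply/setP=> S; apply/imsetP/orbitP => [[i _ ->] | [g Gg <-]].
    have [x Gx ->] := atransP2in (subxx G) trI (in_setT i0) (in_setT i).
    by exists x; rewrite ?setact_orbit_normal.
  by exists (to i0 g); rewrite ?setact_orbit_normal.
- have [i0 _ _] := imsetP trI; rewrite ltnNge; apply: contra ntrL => J_le1.
  apply/imsetP; exists i0 => //; apply/esym/setP=> i; rewrite [RHS]inE.
  have Ji0: orbit to L i0 \in J by apply: imset_f.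
  have Ji: orbit to L i \in J by apply: imset_f.
  by rewrite (card_le1_eqP J_le1 _ _ Ji Ji0) orbit_refl.
- move=> _ /imsetP[i _ ->]; apply: contra (nzW i); rewrite -!submx0.
  by apply: submx_trans; apply: (sumsmx_sup i); rewrite ?orbit_refl.
- move=> S g _ Gg; rewrite sumsmxMr; apply/sumsmx_subP=> i Si.
  by apply: submx_trans (WG i Gg) _; apply: (sumsmx_sup (to i g)); rewrite ?mem_setact.
(* Directness by counting ranks: those of the blocks add up to at most the sum of those of the
   [W i], which is the full dimension. *)
- apply/mxdirectP; apply/eqP; rewrite /= eqn_leq mxrank_sums_leq /=.
  rewrite sumU -sumW (mxdirectP dxW) /= -bigJ.
  by apply: leq_sum => S _; apply: mxrank_sums_leq.
move=> g _ _ Pg /imsetP[i _ ->] /imsetP[j _ ->]; have Gg := subsetP sPG g Pg.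
rewrite !setact_orbit_normal // => eqi; apply/orbit_in_eqP => //.
by apply: (semiregL (i := i)) => //; rewrite -eqi orbit_refl.
Qed.

End OrbitBlocks.

Lemma noncyclic_normal_Qfixed_Pfree (A : {group gT}) :
    mx_irreducible rG -> mx_faithful rG ->
    A <| G -> A \subset P -> abelian A -> ~~ cyclic A ->
  has_Qfixed_Pfree P Q rG.
Proof.
move=> irrG ffulG nsAG sAP cAA ncycA.
have [nsPG defG pP qQ] := pqG; have [sPG _] := andP nsPG.
pose rA := subg_repr rG (normal_sub nsAG).
apply/Qfixed_PfreeP; apply: (socle_exists rA) => sA; apply/Qfixed_PfreeP.
pose to := Clifford_action sA.
have trG: [transitive G, on setT | to] by apply: Clifford_atrans.
(* With a single homogeneous component, all [G]-translates of the simple module [M] would be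
   isomorphic to it, so [A] would be faithful on [M]. An abelian group with a faithful irreducible
   module is cyclic. *)
have nontrivI: ~ forall W W' : sA, W = W'.
  move=> eqW; case/negP: ncycA; have [W0 _ _] := imsetP trG.
  pose M := socle_base W0; have simM: mxsimple rA M := socle_simple W0.
  have modM := mxsimple_module simM.
  apply: (mx_faithful_irr_abelian_cyclic (rG := submod_repr modM)) => //; last first.
    exact/submod_mx_irr.
  have [X sXG [defV _]] := Clifford_basis irrG simM.
  apply: subset_trans ffulG; rewrite rker_submod.
  have sKA := rstab_sub rA M; have sKG := subset_trans sKA (normal_sub nsAG).
  rewrite -[rker _]/(rstab rG 1%:M) -(eqmx_rstab _ defV) rfix_mx_rstabC //.
  apply/sumsmx_subP=> x /(subsetP sXG) Gx; rewrite -rfix_mx_rstabC //.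
  have simMx := Clifford_simple simM Gx; have modMx := mxsimple_module simMx.
  have /(mx_rsim_iso modM modMx)/rker_mx_rsim: mx_iso rA M (M *m rG x).
    apply/component_mx_isoP=> //.
    have eW N (simN : mxsimple rA N) := PackSocleK (component_socle sA simN).
    by rewrite -(eW _ simM) -(eW _ simMx) (eqW (PackSocle _) (PackSocle (component_socle sA simM))).
  by rewrite !rker_submod => ->; rewrite rstab_subg subsetIr.
have WG (W : sA) g : g \in G -> (W *m rG g <= to W g)%MS.
  by move=> Gg; rewrite val_Clifford_act.
have dxW: mxdirect (\sum_(W : sA) (W : 'M_n)) by apply: Socle_direct.
have sumW: (\sum_(W : sA) (W : 'M_n) :=: 1%:M)%MS.
  by rewrite -[X in (X :=: _)%MS]/(Socle sA) (Clifford_Socle1 irrG).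
have [trP | ntrP] := boolP [transitive P, on setT | to]; last first.
  apply: (orbit_blocks_Qfixed_Pfree nsPG trG ntrP _ WG dxW sumW) => [W | g W W' Pg _].
    exact: nz_socle.
  exact: mem_orbit.
have nsPhiG: 'Phi(P)%G <| G by apply: char_normal_trans (Phi_char P) nsPG.
have sPhiP: 'Phi(P) \subset P := Phi_sub P.
apply: (orbit_blocks_Qfixed_Pfree nsPhiG trG _ _ WG dxW sumW) => [|W|g W W' Pg].
- have [W0 _ _] := imsetP trG.
  (* If the Frattini subgroup were transitive, it would generate [P] together with the stabiliser of
     [W0]. That stabiliser would be all of [P], leaving only one component. *)
  apply/(subgroup_transitivePin (in_setT W0) sPhiP sPG trP) => defP.
  have{} defP: 'C_P[W0 | to] = P.
    rewrite -[LHS]genGid; apply: Phi_nongen.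
    rewrite joingC norm_joinEl // (subset_trans (subsetIl _ _)) // (subset_trans sPG) //.
    exact: normal_norm.
  have eqW0 W : W = W0.
    have [x Px ->] := atransP2in sPG trP (in_setT W0) (in_setT W).
    move: Px; rewrite -defP => /setIP[Px]; have Gx := subsetP sPG x Px.
    by rewrite mem_stabiliser // => /eqP.
  by apply: nontrivI => W W'; rewrite (eqW0 W) (eqW0 W').
- exact: nz_socle.
case/orbitP=> l Phil eq_l.
have [x Px ->] := atransP2in sPG trP (in_setT W) (in_setT W').
have [Gg Gx Gl] := And3 (subsetP sPG g Pg) (subsetP sPG x Px) (subsetP (normal_sub nsPhiG) l Phil).
(* [P] is abelian modulo its Frattini subgroup, so [g] moves [to W x] as it moves [W], up to this
   commutator. *)
have Phic: [~ x, g] \in 'Phi(P).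
  by rewrite (subsetP _ _ (mem_commg Px Pg)) // (Phi_joing pP) joing_subl.
have Gc: [~ x, g] \in G by rewrite groupR.
have Gxc := groupM Gx Gc.
have ->: to (to W x) g = to (to W x) (l ^ x * [~ x, g])%g.
  rewrite -(actMin to W Gx Gg) -(actMin to W Gx); last first.
    by apply: groupM => //; apply: groupJ.
  rewrite mulgA -conjgC -mulgA (actMin to W Gl Gxc) eq_l.
  by rewrite -(actMin to W Gg Gxc) mulgA -commgC.
rewrite mem_orbit // groupM // memJ_norm // (subsetP (normal_norm nsPhiG)) //.
Qed.

End Reduction.

(** Freeness modulo [rker rG] lets the induction pass to submodules, where [P] may fail to be
    faithful. The groups vary as well, because a block is treated through its stabiliser. *)
Theorem Qfixed_Pfree n (gT : finGroupType) (G P Q : {group gT})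
    (rG : mx_representation F G n) :
  pq_product G P Q -> has_Qfixed_Pfree P Q rG.
Proof.
elim/ltn_ind: n => n IHn in gT G P Q rG *; move=> pqG.
have [nsPG defG pP qQ] := pqG; have [sPG nPG] := andP nsPG.
have sQG: Q \subset G by rewrite -defG mulG_subr.
have [n0 | n_gt0] := posnP n.
  move: rG; rewrite {}n0 => rG; exists 0; split=> //.
    by apply/subsetP=> x /(subsetP sQG) Gx; rewrite inE Gx mul0mx /=.
  apply/subsetP=> x /setIP[/(subsetP sPG) Gx _].
  by rewrite inE Gx /= [_ *m _]flatmx0 [1%:M]flatmx0.
case: (pickP [pred U : 'M[F]_n | [&& mxmodule rG U, U != 0 & (\rank U < n)%N]]).
  by move=> U /and3P[modU nzU ltUn]; apply: (reducible_Qfixed_Pfree IHn pqG modU).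
move=> irrG0; have irrG: mx_irreducible rG.
  apply/mx_irrP; split=> // U modU nzU; move: (irrG0 U); rewrite /= modU nzU /=.
  by move/negbT; rewrite -leqNgt /row_full eqn_leq rank_leq_col.
have nKG := rker_norm rG.
(* Dividing by the kernel makes the irreducible module faithful, and stabilisers correspond under
   [coset]. *)
have pqGK: pq_product (G / rker rG)%G (P / rker rG)%G (Q / rker rG)%G.
  split; rewrite ?quotient_normal ?quotient_pgroup //=.
  by rewrite -quotientMl ?defG // (subset_trans sPG).
have irrGK: mx_irreducible (kquo_repr rG) by apply/quo_mx_irr.
have ffulGK := kquo_mx_faithful rG.
have [v [nzv sQv sPv]]: has_Qfixed_Pfree (P / rker rG)%G (Q / rker rG)%G (kquo_repr rG).
  have [/existsP[A /and4P[nsA sA cAA ncycA]] | /existsPn cycA] :=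
    boolP [exists A : {group coset_of (rker rG)}, [&& A <| (G / rker rG)%g,
             A \subset (P / rker rG)%g, abelian A & ~~ cyclic A]].
    exact: (noncyclic_normal_Qfixed_Pfree IHn pqGK irrGK ffulGK nsA).
  apply: primitive_Qfixed_Pfree => // A nsA sA cAA.
  by apply: contraR (cycA A) => ncycA; apply/and4P.
have stabE x : x \in G -> (coset (rker rG) x \in rstab (kquo_repr rG) v) = (x \in rstab rG v).
  by move=> Gx; rewrite !inE kquo_repr_coset // Gx mem_quotient.
exists v; split=> //.
  apply/subsetP=> x Qx; rewrite -stabE ?(subsetP sQG) //.
  by rewrite (subsetP sQv) ?mem_quotient.
apply/subsetP=> x /setIP[Px vx]; have Gx := subsetP sPG x Px.
rewrite -stabE // in vx.
have /rkerP[_]: coset (rker rG) x \in rker (kquo_repr rG).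
  by apply: (subsetP sPv); rewrite inE vx mem_quotient.
by rewrite kquo_repr_coset // => rGx; apply/rkerP.
Qed.

End Fixed.

(* QP = Q ⋉ P is realized as an internal semidirect product G with normal
   subgroup P and complement Q (P ><| Q = G).  A right 'F_q[G]-module of
   dimension n is a matrix representation rG acting on row vectors
   (v |-> v *m rG g).  The stabilizer of tau is rstab rG tau. *)
Theorem theorem5p1 (gT : finGroupType) (G P Q : {group gT}) (p q n : nat)
    (rG : mx_representation 'F_q G n) :
  prime p -> prime q -> odd p -> odd q -> p != q ->
  pgroup p P -> pgroup q Q -> (P ><| Q = G)%g ->
  (P :&: rker rG = 1)%g ->
  exists tau : 'rV['F_q]_n, rstab rG tau = Q.
Proof.
move=> p_pr q_pr odd_p odd_q neq_pq pP qQ defG ffulP.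
have [nsPG _ defPQ _ _] := sdprod_context defG.
have [//|v [_ sQv sPv]] :=
  Qfixed_Pfree p_pr q_pr odd_p odd_q neq_pq (pchar_Fp q_pr) (P := P) (Q := Q) rG.
exists v; apply/eqP; rewrite eqEsubset sQv andbT; apply/subsetP=> x vx.
have: x \in (P * Q)%g by rewrite defPQ (subsetP (rstab_sub rG v)).
case/mulsgP=> a b Pa Qb defx; rewrite defx in vx *.
(* The factor [b] fixes [v], so [a] does too; hence [a] acts trivially and is 1 by faithfulness. *)
have va: a \in rstab rG v by rewrite -(groupMr _ (subsetP sQv b Qb)).
have: a \in P :&: rker rG by rewrite inE Pa (subsetP sPv) // inE Pa.
by rewrite ffulP => /set1P ->; rewrite mul1g.
Qed.
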